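(* Let $(X,\mu,T,\mathcal{B})$ with $\mathcal{B}=\{B_n:n\in\mathbb{N}\}$ be a shrinking target system satisfying the long-term independence condition (defined in the context). If $$\sum_{n=1}^\infty \frac{\mu(E_{n})^{1-\epsilon}}{n}<\infty$$ for some $\epsilon>0$, then $\mathcal{H}_{\mathrm{e.a.}}(\mathcal{B})$ has full measure. On the other hand, if $$\sum_{n=1}^\infty\frac{\mu(E_{n})}{n}=\infty,$$ then $\mathcal{H}_{\mathrm{e.a.}}(\mathcal{B})$ has zero measure.
   Context: $\mathbb{N}=\{1,2,3,\dots\}$. A shrinking target system $(X,\mu,T,\mathcal{B})$ consists of a probability space $(X,\mu)$, a measurable map $T\colon X\to X$ preserving $\mu$, and a sequence $\mathcal{B}=\{B_n:n\in\mathbb{N}\}$ of measurable subsets of $X$ that is nested, $B_1\supset B_2\supset\cdots$, with $\lim_{n\to\infty}\mu(B_n)=0$. Put $O_m(x)=\{Tx,T^2x,\dots,T^mx\}$ and $E_m=\{x\in X: O_m(x)\cap B_m=\varnothing\}$. The eventually always hitting set is $$\mathcal{H}_{\mathrm{e.a.}}(\mathcal{B})=\{x\in X: O_m(x)\cap B_m\neq\varnothing\text{ for all but finitely many }m\in\mathbb{N}\}.$$ For $n,m\in\mathbb{N}$ let $\Xi_{n,m}$ be the algebra of subsets of $X$ generated by $\{T^{-j}B_i: 1\leq i\leq m,\ 1\leq j\leq n\}$. Long-term independence condition: there exist a function $\eta\colon\mathbb{N}\to[0,1]$ with $\lim_{m\to\infty}\eta(m)=0$ and a function $F\colon\mathbb{N}\to\mathbb{N}\cup\{0\}$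 such that for some $\delta>0$ one has $F(m)\leq \frac{1}{(\log m)^{1+\delta}\mu(B_m)}$ for all large enough $m$ (the right-hand side being read as $+\infty$ if $\mu(B_m)=0$), and such that for all $m,n\in\mathbb{N}$ with $n\leq m$, all $A\in\Xi_{n,m}$ and all $B\in\Xi_{m,m}$, $$\big|\mu\big(A\cap T^{-(n+F(m))}B\big)-\mu(A)\mu(B)\big|\leq\eta(m)\mu(A)\mu(B).$$ *)

(* Defs.v *)
From HB Require Import structures.
From mathcomp Require Import all_boot all_order all_algebra.
From mathcomp Require Import all_classical all_reals all_analysis.

Set Implicit Arguments.
Unset Strict Implicit.
Unset Printing Implicit Defensive.

Import Order.TTheory GRing.Theory Num.Theory.
Import numFieldNormedType.Exports.

Local Open Scope classical_set_scope.
Local Open Scope ring_scope.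

(* The positive integers are encoded as the n : nat with 0 < n; in particular
   the value B 0 of a sequence of targets B : nat -> set X is never used. *)

Record shrinking_target_system (R : realType) (d : measure_display)
    (X : measurableType d) (mu : probability X R) (T : X -> X)
    (B : nat -> set X) : Prop := ShrinkingTargetSystem {
  sts_measurable_map : measurable_fun setT T ;
  sts_preserving : forall A, measurable A -> mu (T @^-1` A) = mu A ;
  sts_measurable_target : forall n, (0 < n)%N -> measurable (B n) ;
  sts_nested : forall n, (0 < n)%N -> B n.+1 `<=` B n ;
  sts_shrinking : (mu \o B) n @[n --> \oo] --> 0%E
}.

Definition orbit_upto (X : Type) (T : X -> X) (m : nat) (x : X) : set X :=
  [set iter j T x | j in [set j | (1 <= j <= m)%N]].

Definition miss_set (X : Type) (T : X -> X) (B : nat -> set X) (m : nat) :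
    set X :=
  [set x | orbit_upto T m x `&` B m = set0].

Definition eventually_always_hitting (X : Type) (T : X -> X)
    (B : nat -> set X) : set X :=
  [set x | \forall m \near \oo, orbit_upto T m x `&` B m !=set0].

Definition set_algebra (X : Type) (G : set (set X)) : Prop :=
  [/\ G setT, setC_closed G & setU_closed G].

Definition target_algebra (X : Type) (T : X -> X) (B : nat -> set X)
    (n m : nat) : set (set X) :=
  smallest (@set_algebra X)
    [set A | exists i j, [/\ (1 <= i <= m)%N, (1 <= j <= n)%N &
                             A = iter j T @^-1` B i]].

(* The inverse is that of \bar R, where 0^-1 = +oo, so that the bound on F m is
   void when mu (B m) = 0; it also gives +oo at m = 1, where ln m = 0. *)
Definition long_term_independence (R : realType) (d : measure_display)
    (X : measurableType d) (mu : probability X R) (T : X -> X)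
    (B : nat -> set X) : Prop :=
  exists (eta : nat -> R) (F : nat -> nat),
    [/\ forall m, (0 < m)%N -> 0 <= eta m <= 1,
        eta m @[m --> \oo] --> (0 : R),
        exists2 delta : R, 0 < delta &
          \forall m \near \oo,
            ((F m)%:R%:E <=
               ((ln m%:R `^ (1 + delta))%:E * mu (B m))^-1)%E &
        forall m n, (0 < n)%N -> (n <= m)%N ->
          forall A C, target_algebra T B n m A -> target_algebra T B m m C ->
          (`| mu (A `&` iter (n + F m) T @^-1` C) - mu A * mu C |
             <= (eta m)%:E * mu A * mu C)%E].

(* Main.v *)
(* Write [p b n] for the probability that the first [n] iterates avoid [B b], so
   that [miss_set T B n] has probability [p n n]; a point fails to be eventually
   always hitting iff it lies in infinitely many [E n := miss_set T B n].

   Divergence: by stationarity [p b n - p b n.+1 = mu (B b `&` misses b n)], so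
   [p b] is convex and [p n (n - m) <= p n n + m / n].  Skipping a gap of length
   [F n], which costs at most [F n * mu (B n) <= ln n `^ (- (1 + delta))], gives
   for [m <= n] the quasi-independence bound
     [mu (E m `&` E n) <=
        (1 + eta n) mu (E m) (mu (E n) + m / n + ln n `^ (- (1 + delta)))].
   Summed against the weights [1 / (m n)] the error terms are linear in the mean
   of [f := \sum 1_(E n) / n], so the second moment of [f] is asymptotic to the
   square of its mean, and a set disjoint from all late [E n] is null.

   Convergence: let [a = b - b / L].  Packing [k] blocks separated by gaps in
   [1, a] gives [p b a <= (2 p b l)^k] with [l = b / L], while crossing a single
   gap gives [p b a * p b l <= 2 (p b b + F b * mu (B b))].  Hence
   [p b a <= 8 (p b b `^ s + ln b `^ (- (1 + delta) s))] with [s = k / (k + 1)],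
   and [\sum p b a / b] converges for [k] large.  A point of [E m] contributes at
   least [1 / 2L] to the tail [b >= m] of [\sum 1_(misses b a) / b], so Markov's
   inequality bounds the union of the [E m] for [m] large. *)

Require Import Defs.
From HB Require Import structures.
From mathcomp Require Import all_boot all_order all_algebra.
From mathcomp Require Import all_classical all_reals all_analysis.
From mathcomp Require Import measurable_realfun zify ring lra.

Set Implicit Arguments.
Unset Strict Implicit.
Unset Printing Implicit Defensive.

Import Order.TTheory GRing.Theory Num.Theory.
Import numFieldNormedType.Exports.

Local Open Scope classical_set_scope.
Local Open Scope ring_scope.

(** * Real inequalities: sums of decrements and series with logarithmic weights *)

Section RealSums.
Context {R : realType}.
Implicit Types (p d : nat -> R) (n m : nat).

Lemma sub_decrementE p d n m : (forall i, p i - p i.+1 = d i) -> (m <= n)%N ->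
  p (n - m)%N - p n = \sum_(n - m <= i < n) d i.
Proof.
move=> pd mn; under eq_bigr do rewrite -pd.
have := telescope_sumr (fun i => - p i) (leq_subr m n).
rewrite opprK addrC => <-; apply: eq_bigr => i _; by rewrite opprK addrC.
Qed.

Lemma sub_decrement_le p d (c : R) n m :
  (forall i, p i - p i.+1 = d i) -> (forall i, d i <= c) -> (m <= n)%N ->
  p (n - m)%N - p n <= m%:R * c.
Proof.
move=> pd dc mn; rewrite (sub_decrementE pd mn).
apply: (@le_trans _ _ (\sum_(n - m <= i < n) c)); first exact: ler_sum.
by rewrite sumr_const_nat mulr_natl subKn.
Qed.

(** The last [m] decrements are at most [d (n - m)], and the first [n - m] are at least that while
    summing to at most [1 - p (n - m)]. Eliminating [d (n - m)] gives
    [n * (p (n - m) - p n) <= m * (1 - p n)]. *)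
Lemma convex_sub_le p d n m :
  (forall i, p i - p i.+1 = d i) -> {homo d : i j / (i <= j)%N >-> j <= i} ->
  p 0%N <= 1 -> 0 <= p n -> (m <= n)%N -> p (n - m)%N - p n <= m%:R / n%:R.
Proof.
move=> pd dd p0 pn mn.
have [->|n0] := posnP n; first by rewrite sub0n subrr invr0 mulr0.
set q := p (n - m)%N.
have h1 : q - p n <= m%:R * d (n - m)%N.
  rewrite (sub_decrementE pd mn).
  apply: (@le_trans _ _ (\sum_(n - m <= i < n) d (n - m)%N)).
    by apply: ler_sum_nat => i /andP[ni _]; exact: dd.
  by rewrite sumr_const_nat mulr_natl subKn.
have h2 : (n - m)%:R * d (n - m)%N <= p 0%N - q.
  have := sub_decrementE pd (leqnn (n - m)); rewrite subnn => ->.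
  apply: (@le_trans _ _ (\sum_(0 <= i < n - m) d (n - m)%N)).
    by rewrite sumr_const_nat mulr_natl subn0.
  by apply: ler_sum_nat => i /andP[_ ni]; apply: dd; exact: ltnW.
rewrite ler_pdivlMr ?ltr0n//.
have -> : n%:R = (n - m)%:R + m%:R :> R by rewrite -natrD subnK.
have m0 : 0 <= m%:R :> R by [].
have nm0 : 0 <= (n - m)%:R :> R by [].
nra.
Qed.

(* [t = v / u <= 1] satisfies [t `^ (- d) >= 1 + d * (1 - t)]. *)
Lemma powRN_sub_ge (u v d : R) : 0 < v -> v <= u -> 0 < d ->
  d * (u - v) * u `^ (- (1 + d)) <= v `^ (- d) - u `^ (- d).
Proof.
move=> v0 vu d0; have u0 : 0 < u by exact: lt_le_trans vu.
have -> : v `^ (- d) = u `^ (- d) * (v / u) `^ (- d).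
  by rewrite -powRM ?ltW ?divr_gt0// mulrC divfK ?gt_eqF.
have -> : u `^ (- (1 + d)) = u `^ (- d) / u.
  rewrite opprD addrC powRD; last by rewrite (gt_eqF u0) implybT.
  by rewrite powR_inv1// ltW.
rewrite -[X in _ <= _ - X]mulr1 -mulrBr mulrCA -!mulrA.
rewrite ler_pM2l ?powR_gt0// /powR gt_eqF ?divr_gt0//.
have := expR_ge1Dx (- d * ln (v / u)).
have := @le_ln1Dx R (v / u - 1).
rewrite addrCA subrr addr0 => /(_ _)h1 h2.
have {}h1 : ln (v / u) <= v / u - 1.
  by apply: h1; rewrite ltrBrDl subrr divr_gt0.
have -> : (u - v) / u = 1 - v / u by rewrite mulrBl divff ?gt_eqF.
nra.
Qed.

Lemma sum_inv_ln_powR_le (d : R) M N : 0 < d -> (2 < M)%N ->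
  \sum_(M <= n < N) n%:R^-1 * ln n%:R `^ (- (1 + d)) <= ln M.-1%:R `^ (- d) / d.
Proof.
move=> d0 M2.
suff h : (M <= N)%N -> \sum_(M <= n < N) n%:R^-1 * ln n%:R `^ (- (1 + d)) <=
    (ln M.-1%:R `^ (- d) - ln N.-1%:R `^ (- d)) / d.
  have [MN|/ltnW NM] := leqP M N.
    apply: (le_trans (h MN)).
    by rewrite ler_pM2r ?invr_gt0// gerBl powR_ge0.
  by rewrite big_geq// divr_ge0 ?powR_ge0// ltW.
elim: N => [|N IH]; first by rewrite leqn0 => /eqP M0; rewrite M0 in M2.
rewrite leq_eqVlt => /orP[/eqP <-|]; first by rewrite big_geq// subrr mul0r.
rewrite ltnS => MN; rewrite big_nat_recr//=.
have {IH}:= IH MN; set S := \sum_(_ <= _ < _) _ => IH.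
have N2 : (2 < N)%N by exact: leq_trans MN.
have p0 : 0 < N.-1%:R :> R by rewrite ltr0n; lia.
have n0 : 0 < N%:R :> R by rewrite ltr0n; lia.
have l0 : 0 < ln N.-1%:R :> R by rewrite ln_gt0// ltr1n; lia.
(* This is [ln (1 - 1 / N) <= - 1 / N]. *)
have lN : N%:R^-1 <= ln N%:R - ln N.-1%:R :> R.
  have := @le_ln1Dx R (- N%:R^-1).
  have -> : 1 - N%:R^-1 = N.-1%:R / N%:R :> R.
    have -> : N.-1%:R = N%:R - 1 :> R by rewrite -subn1 natrB//; lia.
    by field; rewrite gt_eqF.
  rewrite ln_div ?posrE// ltrN2 invf_lt1// ltr1n => /(_ (ltnW N2)).
  lra.
have h : d * (ln N%:R - ln N.-1%:R) * ln N%:R `^ (- (1 + d)) <=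
    ln N.-1%:R `^ (- d) - ln N%:R `^ (- d).
  by apply: powRN_sub_ge => //; rewrite ler_ln ?posrE// ler_nat leq_pred.
rewrite ler_pdivlMr// mulrDl -lerBrDl.
move: IH; rewrite ler_pdivlMr// => IH.
have h3 : d * N%:R^-1 * ln N%:R `^ (- (1 + d)) <=
    d * (ln N%:R - ln N.-1%:R) * ln N%:R `^ (- (1 + d)).
  by rewrite ler_wpM2r ?powR_ge0// ler_pM2l.
rewrite mulrAC [_ * d]mulrC.
lra.
Qed.

(** For [n >= 1], [1 / n^2 <= 2 (1 / n - 1 / (n + 1))], and the tail from [m] telescopes to at most
    [1 / m]. *)
Lemma sum_ratio_sqr_le m N :
  \sum_(m <= n < N) n%:R^-1 * (m%:R / n%:R) <= 2 :> R.
Proof.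
have [->|m0] := posnP m.
  by rewrite big1// => i _; rewrite mul0r mulr0.
have [Nm|/ltnW mN] := leqP N m; first by rewrite big_geq.
have k0 n : (m <= n)%N -> 0 < n%:R :> R by move=> ?; rewrite ltr0n; lia.
apply: (@le_trans _ _ (2 * m%:R * \sum_(m <= n < N) (n%:R^-1 - n.+1%:R^-1))).
  rewrite mulr_sumr; apply: ler_sum_nat => n /andP[mn _].
  have := k0 _ mn => n0; have := k0 _ (leqnn m) => m0'.
  have -> : n%:R^-1 - n.+1%:R^-1 = (n%:R * (n%:R + 1))^-1 :> R.
    by rewrite -natr1; field; rewrite !gt_eqF// addr_gt0.
  rewrite mulrCA -invfM -mulrA mulrCA ler_pM2l//.
  rewrite ler_pdivlMr ?mulr_gt0 ?addr_gt0//.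
  rewrite mulrC ler_pdivrMr ?mulr_gt0//.
  have : 1 <= n%:R :> R by rewrite ler1n; lia.
  nra.
have := telescope_sumr (fun i : nat => - i%:R^-1 : R) mN.
rewrite opprK addrC => h.
have -> : \sum_(m <= n < N) (n%:R^-1 - n.+1%:R^-1) = m%:R^-1 - N%:R^-1 :> R.
  by rewrite -h; apply: eq_bigr => i _; rewrite opprK addrC.
rewrite mulrBr mulfK ?gt_eqF ?k0// gerBl.
by rewrite mulr_ge0// ?invr_ge0// mulr_ge0.
Qed.
End RealSums.

(** * Real-valued probabilities and a second-moment inequality *)

Section Probability.
Context {R : realType} {d : measure_display} {X : measurableType d}.
Variable mu : probability X R.
Local Notation Pr A := (fine (mu A)).
Implicit Types (A C D : set X) (f g : X -> R).

Lemma fine_probabilityK A : measurable A -> (Pr A)%:E = mu A.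
Proof. by move=> mA; rewrite fineK// fin_num_measure. Qed.

Lemma fine_probability_ge0 A : 0 <= Pr A.
Proof. by apply: fine_ge0; exact: measure_ge0. Qed.

Lemma fine_probability_le1 A : measurable A -> Pr A <= 1.
Proof.
move=> mA; rewrite -lee_fin fine_probabilityK//; exact: probability_le1.
Qed.

Lemma le_fine_probability A C : measurable A -> measurable C -> A `<=` C ->
  Pr A <= Pr C.
Proof.
by move=> mA mC AC; rewrite -lee_fin !fine_probabilityK// le_measure// inE.
Qed.

Lemma fine_probabilityU_le A C : measurable A -> measurable C ->
  Pr (A `|` C) <= Pr A + Pr C.
Proof.
move=> mA mC; rewrite -lee_fin EFinD !fine_probabilityK//.
  exact: measureU2.
exact: measurableU.
Qed.

Lemma fine_probabilityC A : measurable A -> Pr (~` A) = 1 - Pr A.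
Proof.
move=> mA; apply: EFin_inj.
by rewrite EFinB !fine_probabilityK ?probability_setC//; exact: measurableC.
Qed.

Lemma fine_probabilityID A C : measurable A -> measurable C ->
  Pr A = Pr (A `&` C) + Pr (A `&` ~` C).
Proof.
move=> mA mC; apply: EFin_inj.
have mDC : measurable (A `\` C) by exact: measurableD.
rewrite EFinD -setDE !fine_probabilityK//; last exact: measurableI.
by rewrite addeC; exact: measureDI.
Qed.

(** Bundles the side conditions of integration with a finite value, so that linear combinations are
    compared in [R] rather than in [\bar R]. *)
Definition has_integral f (v : R) := [/\ measurable_fun [set: X] f,
  forall x, 0 <= f x & (\int[mu]_x (f x)%:E = v%:E)%E].

Lemma has_integral_indic A : measurable A -> has_integral \1_A (Pr A).
Proof.
move=> mA; split => //.
by rewrite integral_indic// setIT fine_probabilityK.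
Qed.

Lemma has_integralZ (c : R) f v : 0 <= c -> has_integral f v ->
  has_integral (fun x => c * f x) (c * v).
Proof.
move=> c0 [mf f0 fv]; split => [|x|].
- exact: measurable_funM.
- exact: mulr_ge0.
- under eq_integral do rewrite EFinM.
  rewrite ge0_integralZl_EFin//; first by rewrite fv EFinM.
  + by move=> x _; rewrite lee_fin.
  + exact/measurable_EFinP.
Qed.

Lemma has_integralD f g v w : has_integral f v -> has_integral g w ->
  has_integral (fun x => f x + g x) (v + w).
Proof.
move=> [mf f0 fv] [mg g0 gw]; split => [|x|].
- exact: measurable_funD.
- exact: addr_ge0.
- under eq_integral do rewrite EFinD.
  rewrite ge0_integralD//; first by rewrite fv gw EFinD.
  + by move=> x _; rewrite lee_fin.
  + exact/measurable_EFinP.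
  + by move=> x _; rewrite lee_fin.
  + exact/measurable_EFinP.
Qed.

Lemma has_integral_sum (I : eqType) (s : seq I) (F : I -> X -> R) (v : I -> R) :
  (forall i, i \in s -> has_integral (F i) (v i)) ->
  has_integral (fun x => \sum_(i <- s) F i x) (\sum_(i <- s) v i).
Proof.
elim: s => [|i s IH] h.
  rewrite big_nil; under eq_fun do rewrite big_nil.
  by split => //; rewrite integral0.
rewrite big_cons; under eq_fun do rewrite big_cons.
apply: has_integralD; first by apply: h; rewrite mem_head.
by apply: IH => j js; apply: h; rewrite inE js orbT.
Qed.

Lemma le_has_integral f g v w : has_integral f v -> has_integral g w ->
  (forall x, f x <= g x) -> v <= w.
Proof.
move=> [mf f0 fv] [mg g0 gw] fg; rewrite -lee_fin -fv -gw.
apply: ge0_le_integral => //.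
- by move=> x _; rewrite lee_fin.
- exact/measurable_EFinP.
- exact/measurable_EFinP.
- by move=> x _; rewrite lee_fin.
Qed.

(* If [f] vanishes on [D], then [2 S f + S^2 1_D <= f^2 + S^2]; take [S] to be
   the mean of [f] and integrate. *)
Lemma second_moment_avoid (w : nat -> R) (E : nat -> set X) D m n :
  (forall i, 0 <= w i) -> (forall i, measurable (E i)) -> measurable D ->
  (forall i x, (m <= i < n)%N -> E i x -> ~ D x) ->
  (\sum_(m <= i < n) w i * Pr (E i)) ^+ 2 * (1 + Pr D) <=
  \sum_(m <= i < n) \sum_(m <= j < n) w i * w j * Pr (E i `&` E j).
Proof.
move=> w0 mE mD ED; set S := \sum_(m <= i < n) w i * Pr (E i).
rewrite mulrDr mulr1; have S0 : 0 <= S.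
  by apply: sumr_ge0 => i _; rewrite mulr_ge0// fine_probability_ge0.
pose f x := \sum_(m <= i < n) w i * \1_(E i) x.
have fS : has_integral f S.
  by apply: has_integral_sum => i _; apply/has_integralZ/has_integral_indic.
have f2 : has_integral
    (fun x => \sum_(m <= i < n) \sum_(m <= j < n)
       w i * w j * \1_(E i `&` E j) x)
    (\sum_(m <= i < n) \sum_(m <= j < n) w i * w j * Pr (E i `&` E j)).
  apply: has_integral_sum => i _; apply: has_integral_sum => j _.
  apply: has_integralZ; first exact: mulr_ge0.
  by apply: has_integral_indic; exact: measurableI.
have S20 : 0 <= S ^+ 2 by exact: sqr_ge0.
have hl := has_integralD (has_integralZ (mulr_ge0 (ler0n R 2) S0) fS)
  (has_integralZ S20 (has_integral_indic mD)).
have hr := has_integralD f2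
  (has_integralZ S20 (has_integral_indic (measurableT))).
rewrite -(lerD2r (S ^+ 2)).
have -> : S ^+ 2 + S ^+ 2 * Pr D + S ^+ 2 = 2 * S * S + S ^+ 2 * Pr D by ring.
have -> : S ^+ 2 = S ^+ 2 * Pr setT by rewrite probability_setT mulr1.
rewrite -[X in _ * X * _ * Pr D]mulr1.
apply: (le_trans _ (le_has_integral hl hr _)).
  by rewrite probability_setT !mulr1.
move=> x /=.
have -> : \sum_(m <= i < n) \sum_(m <= j < n) w i * w j * \1_(E i `&` E j) x =
    f x ^+ 2.
  rewrite expr2 [in RHS]/f mulr_suml; apply: eq_bigr => i _.
  rewrite mulr_sumr; apply: eq_bigr => j _.
  by rewrite indicI /= mulrACA.
rewrite indicT /= mulr1 [\1_D x]indicE.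
case: (asboolP (D x)) => Dx.
  have -> : f x = 0.
    rewrite /f big_nat big1// => i mi; rewrite indicE memNset ?mulr0// => Ex.
    exact: ED mi Ex Dx.
  by rewrite mem_set// mulr0 add0r mulr1 lerDr sqr_ge0.
rewrite memNset// mulr0 addr0 -subr_ge0.
have -> : f x ^+ 2 + S ^+ 2 - 2 * S * f x = (f x - S) ^+ 2 by ring.
exact: sqr_ge0.
Qed.

End Probability.

(** * Avoidance events along an orbit *)

Section Misses.
Context {X : Type}.
Variables (T : X -> X) (B : nat -> set X).

(* [miss_set T B m] with the length of the orbit decoupled from the index of the
   target. *)
Definition misses b n : set X :=
  [set x | forall j, (1 <= j <= n)%N -> ~ B b (iter j T x)].

Lemma miss_setE m : miss_set T B m = misses m m.
Proof.
apply/seteqP; split => x /=.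
  move=> x0 j jm Bj; suff : set0 (iter j T x) by [].
  by rewrite -x0; split => //; exists j.
move=> h; apply/seteqP; split => // _ [[j /= jm <-]]; exact: h.
Qed.

Lemma misses0 b : misses b 0 = setT.
Proof. by apply/seteqP; split => // x _ j; rewrite leqn0; case: j. Qed.

Lemma sub_misses b c m n : (n <= m)%N -> (B c `<=` B b) ->
  misses b m `<=` misses c n.
Proof.
move=> nm cb x h j /andP[j1 jn] /cb; apply: h; rewrite j1 /=.
exact: leq_trans nm.
Qed.

Lemma missesD b n k :
  misses b (n + k) = misses b n `&` iter n T @^-1` misses b k.
Proof.
apply/seteqP; split => x /=.
  move=> h; split=> j /andP[j1 jn]; first by apply: h; lia.
  by rewrite -iterD; apply: h; lia.
move=> [h1 h2] j /andP[j1 jn].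
have [jn'|jn'] := leqP j n; first by apply: h1; rewrite j1.
rewrite -(subnK (ltnW jn')) iterD; apply: h2.
by rewrite subn_gt0 jn' leq_subLR.
Qed.

Lemma misses1 b : misses b 1 = T @^-1` (~` B b).
Proof.
apply/seteqP; split => x /= h; first exact: (h 1%N).
by move=> [|[|j]].
Qed.

Lemma set_algebraI (G : set (set X)) : set_algebra G -> setI_closed G.
Proof.
move=> [_ GC GU] A C GA GC'; rewrite -[A `&` C]setCK setCI.
by apply/GC/GU; exact: GC.
Qed.

(** An avoidance event is a finite intersection of complements of generators; this makes the
    independence condition applicable to it. *)
Lemma target_algebra_misses b k n m : (1 <= b <= m)%N -> (k <= n)%N ->
  target_algebra T B n m (misses b k).
Proof.
move=> bm; elim: k => [|k IH] kn G [Galg Ggen].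
  by rewrite misses0; case: Galg.
rewrite -addn1 missesD misses1; apply: set_algebraI => //.
  by apply: IH => //; exact: ltnW.
rewrite preimage_setC; have [_ GC _] := Galg; apply: GC; apply: Ggen.
by exists b, k.+1.
Qed.

End Misses.

(** * Consequences of the invariance of the measure *)

Section Stationary.
Context {R : realType} {d : measure_display} {X : measurableType d}.
Variables (mu : probability X R) (T : X -> X) (B : nat -> set X).
Hypothesis sys : shrinking_target_system mu T B.
Local Notation Pr A := (fine (mu A)).
Local Notation M := (misses T B).

Lemma target_nested b c : (0 < b)%N -> (b <= c)%N -> B c `<=` B b.
Proof.
move=> b0; elim: c => [|c IH].
  by rewrite leqn0 => /eqP b00; rewrite b00 in b0.
rewrite leq_eqVlt => /orP[/eqP <-//|]; rewrite ltnS => bc.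
apply: subset_trans (IH bc); apply: sts_nested sys _ _.
exact: leq_trans bc.
Qed.

Lemma measurable_iter_preimage n A :
  measurable A -> measurable (iter n T @^-1` A).
Proof.
move=> mA; elim: n => [//|n IH].
rewrite (_ : iter n.+1 T @^-1` A = T @^-1` (iter n T @^-1` A)).
  by rewrite -[X in measurable X]setTI; apply: (sts_measurable_map sys).
by apply/seteqP; split => x /=; rewrite -iterS iterSr.
Qed.

Lemma probability_iter_preimage n A :
  measurable A -> mu (iter n T @^-1` A) = mu A.
Proof.
move=> mA; elim: n => [//|n IH].
rewrite -IH -[RHS](sts_preserving sys); last exact: measurable_iter_preimage.
by congr (mu _); apply/seteqP; split => x /=; rewrite -iterS iterSr.
Qed.

Lemma measurable_misses b n : (0 < b)%N -> measurable (M b n).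
Proof.
move=> b0; elim: n => [|n IH]; first by rewrite misses0.
rewrite -addn1 missesD misses1; apply: measurableI => //.
apply: measurable_iter_preimage; apply: (measurable_iter_preimage 1).
by apply: measurableC; exact: sts_measurable_target sys _ _.
Qed.

Lemma measurable_miss_set n : measurable (miss_set T B n).
Proof.
(* [B 0] need not be measurable, but at [n = 0] no iterate is tested and the event is the whole
   space. *)
rewrite miss_setE; case: n => [|n]; last exact: measurable_misses.
by rewrite misses0.
Qed.

(** Split off the first iterate rather than the last: [M b n.+1] is the part of the preimage of
    [M b n] outside the preimage of [B b], and invariance removes the preimages. The event obtained
    decreases with [n]. *)
Lemma probability_misses_decrement b n : (0 < b)%N ->
  Pr (M b n) - Pr (M b n.+1) = Pr (B b `&` M b n).
Proof.
move=> b0; have mB := sts_measurable_target sys b0.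
have mM := measurable_misses n b0.
have e1 : M b n.+1 = T @^-1` M b n `&` ~` (T @^-1` B b).
  by rewrite -add1n missesD misses1 setIC.
have e : Pr (M b n) = Pr (T @^-1` M b n) by rewrite (sts_preserving sys).
have mT : forall A, measurable A -> measurable (T @^-1` A).
  by move=> A; exact: (measurable_iter_preimage 1).
rewrite e e1 (fine_probabilityID mu (mT _ mM) (mT _ mB)) addrK -preimage_setI.
by rewrite (sts_preserving sys) 1?setIC//; exact: measurableI.
Qed.

Lemma probability_misses_sub_le b n m : (0 < b)%N -> (m <= n)%N ->
  Pr (M b (n - m)) - Pr (M b n) <= m%:R * Pr (B b).
Proof.
move=> b0 mn.
apply: (sub_decrement_le (fun i => probability_misses_decrement i b0) _ mn) => i.
have mB := sts_measurable_target sys b0.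
apply: le_fine_probability => //.
by apply: measurableI => //; exact: measurable_misses.
Qed.

Lemma probability_misses_ge b n :
  (0 < b)%N -> 1 - n%:R * Pr (B b) <= Pr (M b n).
Proof.
move=> b0; have := probability_misses_sub_le b0 (leqnn n).
rewrite subnn misses0 probability_setT /=; lra.
Qed.

(* By stationarity the decrements are those of a convex sequence. *)
Lemma probability_misses_ratio_le b n m : (0 < b)%N -> (m <= n)%N ->
  Pr (M b (n - m)) <= Pr (M b n) + m%:R / n%:R.
Proof.
move=> b0 mn; rewrite -lerBlDl.
apply: (convex_sub_le (fun i => probability_misses_decrement i b0)) => //.
- move=> i j ij; have mB := sts_measurable_target sys b0.
  apply: le_fine_probability; [..|by apply: setIS; exact: sub_misses].
    by apply: measurableI => //; exact: measurable_misses.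
  by apply: measurableI => //; exact: measurable_misses.
- by rewrite misses0 probability_setT.
- exact: fine_probability_ge0.
Qed.

End Stationary.

(** * Consequences of long-term independence *)

Section Independence.
Context {R : realType} {d : measure_display} {X : measurableType d}.
Variables (mu : probability X R) (T : X -> X) (B : nat -> set X).
Variables (eta : nat -> R) (F : nat -> nat).
Hypothesis sys : shrinking_target_system mu T B.
Hypothesis indep : forall m n, (0 < n)%N -> (n <= m)%N ->
  forall A C, target_algebra T B n m A -> target_algebra T B m m C ->
  (`| mu (A `&` iter (n + F m) T @^-1` C) - mu A * mu C |
     <= (eta m)%:E * mu A * mu C)%E.
Local Notation Pr A := (fine (mu A)).
Local Notation M := (misses T B).

(** The targets [b] and [c] may differ, as needed for the correlation of two miss sets; the block
    estimates use [b = c]. *)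
Lemma misses_indep m n k b c l : (0 < n <= m)%N -> (0 < b <= m)%N ->
    (0 < c <= m)%N -> (l <= n)%N -> (k <= m)%N ->
  `|Pr (M b l `&` iter (n + F m) T @^-1` M c k) - Pr (M b l) * Pr (M c k)|
     <= eta m * (Pr (M b l) * Pr (M c k)).
Proof.
move=> /andP[n0 nm] bm cm ln km.
have [b0 c0] : (0 < b)%N /\ (0 < c)%N by lia.
have mA := measurable_misses sys l b0; have mC := measurable_misses sys k c0.
have mI : measurable (M b l `&` iter (n + F m) T @^-1` M c k).
  by apply: measurableI => //; exact: (measurable_iter_preimage sys).
have := indep n0 nm (target_algebra_misses bm ln) (target_algebra_misses cm km).
rewrite -(fine_probabilityK mu mI) -(fine_probabilityK mu mA).
rewrite -(fine_probabilityK mu mC).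
by rewrite -!EFinM -EFinB abse_EFin lee_fin mulrA.
Qed.

(** Ignoring the visits during the gap only enlarges the event. *)
Lemma probability_misses_split_le b n k : (0 < n <= b)%N -> (k <= b)%N ->
  Pr (M b (n + F b + k)) <= (1 + eta b) * (Pr (M b n) * Pr (M b k)).
Proof.
move=> /andP[n0 nb] kb; have b0 : (0 < b)%N by exact: leq_trans nb.
have nb' : (0 < n <= b)%N by rewrite n0.
have bb : (0 < b <= b)%N by rewrite b0 /=.
have := misses_indep nb' bb bb (leqnn n) kb.
have : Pr (M b (n + F b + k)) <= Pr (M b n `&` iter (n + F b) T @^-1` M b k).
  have mM i : measurable (M b i) by exact: (measurable_misses sys).
  apply: le_fine_probability => //.
    by apply: measurableI => //; exact: (measurable_iter_preimage sys).
  rewrite missesD; apply: setSI; apply: sub_misses => //; exact: leq_addr.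
by move=> h /ler_normlW; lra.
Qed.

(** Conversely, what is gained by ignoring the gap lies in the event of a hit during the gap, of
    probability at most [F b * mu (B b)]. *)
Lemma probability_misses_split_ge b n k : (0 < n <= b)%N -> (k <= b)%N ->
  (1 - eta b) * (Pr (M b n) * Pr (M b k)) - (F b)%:R * Pr (B b) <=
  Pr (M b (n + F b + k)).
Proof.
move=> /andP[n0 nb] kb; have b0 : (0 < b)%N by exact: leq_trans nb.
have nb' : (0 < n <= b)%N by rewrite n0.
have bb : (0 < b <= b)%N by rewrite b0 /=.
have := misses_indep nb' bb bb (leqnn n) kb.
have mM i : measurable (M b i) by exact: (measurable_misses sys).
have mI i A (mA : measurable A) := measurable_iter_preimage sys i mA.
have mC := measurableC (mM (F b)).
have h1 : Pr (M b n `&` iter (n + F b) T @^-1` M b k) <=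
    Pr (M b (n + F b + k)) + Pr (iter n T @^-1` ~` M b (F b)).
  have mA := mI n _ mC.
  apply: le_trans (fine_probabilityU_le mu (mM _) mA).
  apply: le_fine_probability.
  - by apply: measurableI => //; exact: mI.
  - exact: measurableU.
  rewrite 2!missesD => x /= [Ax Cx].
  by have [|] := pselect (M b (F b) (iter n T x)); [left|right].
have := probability_misses_ge sys (F b) b0.
move: h1; rewrite (probability_iter_preimage sys)// fine_probabilityC//.
move=> h1 h2.
by rewrite distrC => /ler_normlW; lra.
Qed.

(** Of the [n] iterates avoiding [B n], keep those after time [m + F n], which are nearly
    independent of [M m m]. Restoring [F n] iterates costs [F n * mu (B n)], and restoring [m] more
    costs [m / n] by convexity. *)
Lemma probability_miss_setI_le m n : (0 < m <= n)%N -> 0 <= eta n ->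
  Pr (M m m `&` M n n) <= (1 + eta n) * (Pr (M m m) *
    (Pr (M n n) + (m%:R / n%:R + (F n)%:R * Pr (B n)))).
Proof.
move=> /andP[m0 mn] eta0; have n0 : (0 < n)%N by exact: leq_trans mn.
(* The subtraction is truncated: if the gap reaches past [n], then [l = 0] and [M n l] is the whole
   space. *)
set l := (n - m - F n)%N.
have mm : (0 < m <= n)%N by rewrite m0.
have nn : (0 < n <= n)%N by rewrite n0 /=.
have ln : (l <= n)%N by rewrite /l; lia.
have mM c i : (0 < c)%N -> measurable (M c i) by exact: (measurable_misses sys).
have h1 := misses_indep mm mm nn (leqnn m) ln.
have h2 : Pr (M m m `&` M n n) <= Pr (M m m `&` iter (m + F n) T @^-1` M n l).
  apply: le_fine_probability.
  - by apply: measurableI; exact: mM.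
  - apply: measurableI; first exact: mM.
    by apply: (measurable_iter_preimage sys); exact: mM.
  apply: setIS => x h j /andP[j1 jl]; rewrite -iterD; apply: h; lia.
have h3 : Pr (M n l) <= Pr (M n (n - m)) + (F n)%:R * Pr (B n).
  have [Fn|Fn] := leqP (F n) (n - m).
    by have := probability_misses_sub_le sys n0 Fn; rewrite /l; lra.
  have := probability_misses_sub_le sys n0 (leqnn (n - m)).
  rewrite subnn (_ : l = 0)%N; last by rewrite /l; lia.
  have : (n - m)%:R * Pr (B n) <= (F n)%:R * Pr (B n).
    by rewrite ler_wpM2r ?fine_probability_ge0// ler_nat ltnW.
  lra.
have h4 := probability_misses_ratio_le sys n0 mn.
have {h3 h4} h5 : Pr (M n l) <=
    Pr (M n n) + (m%:R / n%:R + (F n)%:R * Pr (B n)).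
  lra.
apply: (@le_trans _ _ ((1 + eta n) * (Pr (M m m) * Pr (M n l)))).
  by move: h1 => /ler_normlW; lra.
rewrite ler_pM2l; last lra.
by rewrite ler_wpM2l ?fine_probability_ge0.
Qed.

End Independence.

(** * Series with nonnegative terms *)

Section Series.
Context {R : realType}.
Implicit Types u : nat -> R.

Lemma sum_nat_nondecreasing u m :
  (forall n, 0 <= u n) ->
  {homo (fun N => \sum_(m <= n < N) u n) : i j / (i <= j)%N >-> i <= j}.
Proof.
move=> u0 i j ij; have [mi|im] := leqP m i.
  by rewrite (big_cat_nat mi ij)/= lerDl sumr_ge0.
by rewrite big_geq ?sumr_ge0// ltnW.
Qed.

(** Once a partial sum is within [e] of the supremum, at most [e] is left for all later terms
    together. *)
Lemma sum_tail_le u m (K : R) : (forall n, 0 <= u n) ->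
  (forall N, \sum_(m <= n < N) u n <= K) ->
  forall e : R, 0 < e ->
  \forall k \near \oo, forall N, \sum_(k <= n < N) u n <= e.
Proof.
move=> u0 uK e e0.
set S := [set x | exists N, x = \sum_(m <= n < N) u n].
have supS : has_sup S.
  split; first by exists (\sum_(m <= n < 0) u n), 0%N.
  by exists K => _ [N ->].
have [_ [N0 ->] hN0] := sup_adherent e0 supS.
exists (maxn m N0) => // k /=; rewrite geq_max => /andP[mk Nk] N.
have [Nk'|kN] := leqP N k; first by rewrite big_geq// ltW.
have h1 : \sum_(m <= n < N) u n <= sup S.
  by apply: sup_upper_bound => //; exists N.
have h2 := sum_nat_nondecreasing m u0 Nk.
move: h1; rewrite (big_cat_nat mk (ltnW kN))/=.
move: hN0 h2 => /=; lra.
Qed.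

Lemma nneseries_ltyP u m : (forall n, 0 <= u n) ->
  (\sum_(m <= n <oo) (u n)%:E < +oo)%E <->
  exists K : R, forall N, \sum_(m <= n < N) u n <= K.
Proof.
move=> u0.
have u0' n : (m <= n)%N -> true -> (0 <= (u n)%:E)%E by rewrite lee_fin.
split=> [uoo|[K uK]].
  have fu : (\sum_(m <= n <oo) (u n)%:E)%E \is a fin_num.
    by rewrite ge0_fin_numE// nneseries_ge0.
  exists (fine (\sum_(m <= n <oo) (u n)%:E)%E) => N.
  rewrite -lee_fin fineK// -sumEFin; exact: nneseries_lim_ge.
apply: (@le_lt_trans _ _ K%:E); last exact: ltry.
apply: lime_le; first exact: is_cvg_nneseries.
by apply: nearW => N; rewrite sumEFin lee_fin.
Qed.

Lemma near_ln_ge (A : R) : \forall n \near \oo, A <= ln n%:R.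
Proof.
exists (Num.bound (expR A)) => // n /= hn.
have h : expR A <= n%:R.
  apply: le_trans (ltW (archi_boundP (expR_ge0 A))) _.
  by rewrite ler_nat.
have n0 : 0 < n%:R :> R by exact: lt_le_trans (expR_gt0 A) h.
by rewrite -[A]expRK ler_ln// posrE ?expR_gt0.
Qed.

End Series.

(** * The eventually always hitting set as a lower limit of sets *)

Section EventuallyAlways.
Context {R : realType} {d : measure_display} {X : measurableType d}.
Variables (mu : probability X R) (T : X -> X) (B : nat -> set X).
Hypothesis sys : shrinking_target_system mu T B.
Local Notation E := (miss_set T B).

Lemma eventually_always_hittingE :
  eventually_always_hitting T B =
  \bigcup_m \bigcap_(n in [set n | (m <= n)%N]) ~` E n.
Proof.
have h n x : (orbit_upto T n x `&` B n !=set0) <-> (~` E n) x.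
  split=> [[y xy] x0|x0]; first by rewrite x0 in xy.
  by apply/set0P/eqP.
apply/seteqP; split => x.
  by move=> [m _ hm]; exists m => // n mn; apply/h/hm.
by move=> [m _ hm]; exists m => // n mn; apply/h/hm.
Qed.

Lemma measurable_eventually_always_hitting :
  measurable (eventually_always_hitting T B).
Proof.
rewrite eventually_always_hittingE; apply: bigcupT_measurable => m.
apply: bigcap_measurable; first by exists m => /=.
by move=> n _; apply: measurableC; exact: (measurable_miss_set sys).
Qed.

End EventuallyAlways.

(** * The divergence case: zero measure *)

Section Divergence.
Context {R : realType} {d : measure_display} {X : measurableType d}.
Variables (mu : probability X R) (T : X -> X) (B : nat -> set X).
Variables (eta : nat -> R) (F : nat -> nat) (delta : R).
Hypothesis sys : shrinking_target_system mu T B.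
Hypothesis indep : forall m n, (0 < n)%N -> (n <= m)%N ->
  forall A C, target_algebra T B n m A -> target_algebra T B m m C ->
  (`| mu (A `&` iter (n + F m) T @^-1` C) - mu A * mu C |
     <= (eta m)%:E * mu A * mu C)%E.
Hypothesis eta_ge0 : forall m, (0 < m)%N -> 0 <= eta m.
Hypothesis eta_cvg0 : eta m @[m --> \oo] --> (0 : R).
Hypothesis delta0 : 0 < delta.
Local Notation Pr A := (fine (mu A)).
Local Notation M := (misses T B).
Local Notation E := (miss_set T B).
Local Notation q n := (ln n%:R `^ (- (1 + delta))).
Hypothesis gap : \forall n \near \oo, (F n)%:R * Pr (B n) <= q n.

Lemma near_eta_le e : 0 < e -> \forall n \near \oo, eta n <= e.
Proof.
move=> e0; have /cvgr0Pnorm_le/(_ _ e0) := eta_cvg0.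
by apply: filterS => n; exact/le_trans/ler_norm.
Qed.

(** For [i <= j] the correlation exceeds the main product by a term whose sum over [j] is bounded
    uniformly in [i], so the total error is linear in the first moment. The factor 4 combines
    [1 + eps <= 2] with the two orders of a pair. *)
Lemma sum_miss_correlation_le (eps : R) (m N : nat) :
  0 < eps <= 1 -> (2 < m)%N ->
  (forall n, (m <= n)%N -> eta n <= eps) ->
  (forall n, (m <= n)%N -> (F n)%:R * Pr (B n) <= q n) ->
  \sum_(m <= i < N) \sum_(m <= j < N) i%:R^-1 * j%:R^-1 * Pr (E i `&` E j) <=
  (1 + eps) * (\sum_(m <= i < N) i%:R^-1 * Pr (E i)) ^+ 2 +
  4 * (2 + ln m.-1%:R `^ (- delta) / delta) *
    \sum_(m <= i < N) i%:R^-1 * Pr (E i).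
Proof.
move=> /andP[eps0 eps1] m2 etaE gapE.
set S := \sum_(m <= i < N) i%:R^-1 * Pr (E i).
set L := ln m.-1%:R `^ (- delta) / delta.
pose r (i j : nat) : R := i%:R / j%:R + q j.
(* The error is set to 0 for [j < i], so that [G i j + G j i] serves every pair; on the diagonal it
   counts twice, which is harmless as [G >= 0]. *)
pose G (i j : nat) : R :=
  if (i <= j)%N then 2 * (i%:R^-1 * Pr (E i)) * (j%:R^-1 * r i j) else 0.
have P0 A : 0 <= Pr A by exact: fine_probability_ge0.
have r0 i j : 0 <= r i j by rewrite addr_ge0 ?powR_ge0 ?divr_ge0.
have w0 (i : nat) : 0 <= i%:R^-1 :> R by rewrite invr_ge0.
have G0 i j : 0 <= G i j.
  by rewrite /G; case: ifP => // _; rewrite !mulr_ge0.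
have half i j : (m <= i <= j)%N -> i%:R^-1 * j%:R^-1 * Pr (E i `&` E j) <=
    (1 + eps) * ((i%:R^-1 * Pr (E i)) * (j%:R^-1 * Pr (E j))) + G i j.
  move=> /andP[mi ij]; rewrite /G ij.
  have ij0 : (0 < i <= j)%N by rewrite ij andbT; lia.
  have mj : (m <= j)%N by exact: leq_trans ij.
  have j0 : (0 < j)%N by lia.
  have := probability_miss_setI_le sys indep ij0 (eta_ge0 j0).
  rewrite -!miss_setE => h.
  have {h} h : Pr (E i `&` E j) <=
      (1 + eps) * (Pr (E i) * Pr (E j)) + 2 * (Pr (E i) * r i j).
    have hr : i%:R / j%:R + (F j)%:R * Pr (B j) <= r i j by rewrite lerD2l gapE.
    have h1 : Pr (E i) * (Pr (E j) + (i%:R / j%:R + (F j)%:R * Pr (B j))) <=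
              Pr (E i) * (Pr (E j) + r i j).
      by rewrite ler_wpM2l// lerD2l.
    have h0 := eta_ge0 j0; have h2 := etaE _ mj.
    have h3 : 0 <= Pr (E i) * (Pr (E j) + r i j) by rewrite mulr_ge0// addr_ge0.
    have h4 : 0 <= Pr (E i) * r i j by rewrite mulr_ge0.
    apply: (le_trans h).
    apply: (@le_trans _ _ ((1 + eps) * (Pr (E i) * (Pr (E j) + r i j)))).
      apply: (@le_trans _ _ ((1 + eta j) * (Pr (E i) * (Pr (E j) + r i j)))).
        by rewrite ler_wpM2l// addr_ge0.
      by rewrite ler_wpM2r// lerD2l.
    nra.
  have ww : 0 <= i%:R^-1 * j%:R^-1 :> R by rewrite mulr_ge0.
  by have := ler_wpM2l ww h; lra.
apply: (@le_trans _ _ (\sum_(m <= i < N) \sum_(m <= j < N)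
   ((1 + eps) * ((i%:R^-1 * Pr (E i)) * (j%:R^-1 * Pr (E j))) +
    (G i j + G j i)))).
  apply: ler_sum_nat => i /andP[mi _]; apply: ler_sum_nat => j /andP[mj _].
  have [ij|ji] := leqP i j.
    by have := half i j; rewrite mi ij => /(_ isT) h; have := G0 j i; lra.
  have := half j i; rewrite mj ltnW// => /(_ isT) h; have := G0 i j.
  by rewrite setIC [i%:R^-1 * j%:R^-1]mulrC; lra.
have -> : (1 + eps) * S ^+ 2 = \sum_(m <= i < N) \sum_(m <= j < N)
   ((1 + eps) * ((i%:R^-1 * Pr (E i)) * (j%:R^-1 * Pr (E j)))).
  rewrite expr2 {1}/S mulr_suml mulr_sumr; apply: eq_bigr => i _.
  by rewrite mulrCA !mulr_sumr; apply: eq_bigr => j _; rewrite mulrCA.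
under eq_bigr do rewrite big_split/= big_split/=.
rewrite big_split/= lerD2l big_split/=.
rewrite [X in _ + X <= _]exchange_big/= -mulr2n -[_ *+ 2]mulr_natl.
have -> : 4 * (2 + L) * S = 2 * (2 * (2 + L) * S) by ring.
rewrite ler_pM2l// mulr_sumr; apply: ler_sum_nat => i /andP[mi iN].
rewrite /G -big_mkcond/=.
rewrite -(@big_nat_widenl _ _ _ i m N xpredT)// -mulr_sumr.
rewrite [leRHS]mulrAC ler_wpM2l ?mulr_ge0//.
under eq_bigr do rewrite mulrDr.
rewrite big_split/= lerD//.
  exact: sum_ratio_sqr_le.
(* The range [[i, N)] is enlarged to [[m, N)] to make the bound independent of [i]. *)
apply: le_trans (sum_inv_ln_powR_le N delta0 m2).
rewrite [leRHS](big_cat_nat mi (ltnW iN))/= lerDr sumr_ge0// => j _.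
by rewrite mulr_ge0// powR_ge0.
Qed.

(** If [D] had positive measure [2 * eps], the lower and upper bounds on the second moment would
    give [S^2 (1 + 2 eps) <= (1 + eps) S^2 + K S], hence [S <= K / eps] for all partial sums from
    [m] on, against divergence. *)
Lemma never_missing_null k :
  (\sum_(1 <= n <oo) (mu (E n) / n%:R%:E) = +oo)%E ->
  mu (\bigcap_(n in [set n | (k <= n)%N]) ~` E n) = 0%E.
Proof.
move=> divE; set D := \bigcap_(_ in _) _.
have mE := measurable_miss_set sys.
have mD : measurable D.
  apply: bigcap_measurable; first by exists k => /=.
  by move=> n _; exact: measurableC.
rewrite -(fine_probabilityK mu mD); congr EFin.
apply/eqP; rewrite eq_le fine_probability_ge0 andbT leNgt; apply/negP => D0.
set eps := Pr D / 2.
have eps1 : 0 < eps <= 1.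
  by have := fine_probability_le1 mu mD; rewrite /eps; lra.
have [eps0 _] := andP eps1.
have [m [m2 km etaE gapE]] : exists m, [/\ (2 < m)%N, (k <= m)%N,
    forall n, (m <= n)%N -> eta n <= eps &
    forall n, (m <= n)%N -> (F n)%:R * Pr (B n) <= q n].
  have [m1 _ h1] := near_eta_le eps0.
  have [m2 _ h2] := gap.
  exists (maxn 3 (maxn k (maxn m1 m2))).
  by split=> [||n hn|n hn]; [lia|lia|apply: h1 => /=; lia|apply: h2 => /=; lia].
pose u (n : nat) : R := n%:R^-1 * Pr (E n).
have u0 n : 0 <= u n by rewrite mulr_ge0// ?invr_ge0// fine_probability_ge0.
suff : (\sum_(1 <= n <oo) (u n)%:E < +oo)%E.
  rewrite (_ : (\sum_(1 <= n <oo) (u n)%:E)%E = +oo%E) ?ltxx// -divE.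
  apply: (@congr_lim _ (fun N => \sum_(1 <= n < N) (u n)%:E)%E).
  apply/funext => N; apply: eq_big_nat => n /andP[n0 _].
  rewrite inver pnatr_eq0 -leqn0 leqNgt n0/= /u mulrC EFinM fine_probabilityK//.
apply/nneseries_ltyP => //.
set K := 4 * (2 + ln m.-1%:R `^ (- delta) / delta).
have K0 : 0 <= K by rewrite mulr_ge0// addr_ge0// divr_ge0 ?powR_ge0// ltW.
exists (\sum_(1 <= n < m) u n + K / eps) => N.
apply: (@le_trans _ _ (\sum_(1 <= n < maxn m N) u n)).
  by apply: sum_nat_nondecreasing => //; exact: leq_maxr.
rewrite (@big_cat_nat _ _ _ m)//=; [|lia|lia].
rewrite lerD2l; set N' := maxn m N; set S := \sum_(m <= n < N') u n.
have S0 : 0 <= S by rewrite sumr_ge0.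
have hQ := sum_miss_correlation_le N' eps1 m2 etaE gapE.
have := @second_moment_avoid _ _ _ mu (fun n => n%:R^-1) E D m N' _ mE mD _.
move=> /(_ _ _) h.
have {h hQ} : S ^+ 2 * (1 + Pr D) <= (1 + eps) * S ^+ 2 + K * S.
  apply: le_trans hQ; apply: h => [n|n x /andP[mn _] Ex Dx].
    by rewrite invr_ge0.
  by apply: (Dx n) => //=; exact: leq_trans mn.
have -> : Pr D = 2 * eps by rewrite /eps; lra.
move=> h; rewrite ler_pdivlMr//.
have [->|Sn0] := eqVneq S 0; first by rewrite mul0r.
have Sgt0 : 0 < S by rewrite lt_def Sn0.
rewrite -(ler_pM2r Sgt0); move: h; nra.
Qed.

Lemma eventually_always_hitting_null :
  (\sum_(1 <= n <oo) (mu (E n) / n%:R%:E) = +oo)%E ->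
  mu (eventually_always_hitting T B) = 0%E.
Proof.
move=> divE; rewrite eventually_always_hittingE.
have mE := measurable_miss_set sys.
have mD k : measurable (\bigcap_(n in [set n | (k <= n)%N]) ~` E n).
  apply: bigcap_measurable; first by exists k => /=.
  by move=> n _; exact: measurableC.
apply/negligibleP; first exact: bigcupT_measurable.
apply: negligible_bigcup => k; apply/negligibleP => //.
exact: never_missing_null.
Qed.

End Divergence.

(** * The convergence case: full measure *)

Section Convergence.
Context {R : realType} {d : measure_display} {X : measurableType d}.
Variables (mu : probability X R) (T : X -> X) (B : nat -> set X).
Variables (eta : nat -> R) (F : nat -> nat) (delta : R).
Hypothesis sys : shrinking_target_system mu T B.
Hypothesis indep : forall m n, (0 < n)%N -> (n <= m)%N ->
  forall A C, target_algebra T B n m A -> target_algebra T B m m C ->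
  (`| mu (A `&` iter (n + F m) T @^-1` C) - mu A * mu C |
     <= (eta m)%:E * mu A * mu C)%E.
Hypothesis eta_cvg0 : eta m @[m --> \oo] --> (0 : R).
Hypothesis delta0 : 0 < delta.
Local Notation Pr A := (fine (mu A)).
Local Notation M := (misses T B).
Local Notation E := (miss_set T B).
Local Notation q n := (ln n%:R `^ (- (1 + delta))).
Hypothesis gap : \forall n \near \oo, (F n)%:R * Pr (B n) <= q n.

(** One block with its gap is split off at a time, each at the cost of a factor [1 + eta b <= 2];
    the total length stays at most [b], as the independence condition requires. *)
Lemma probability_misses_blocks_le b l k : (0 < l <= b)%N -> eta b <= 1 ->
  (k * (l + F b) <= b)%N ->
  Pr (M b (k * (l + F b))) <= (2 * Pr (M b l)) ^+ k.
Proof.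
move=> lb eta1; elim: k => [|k IH] kb.
  by rewrite mul0n misses0 probability_setT.
have {}kb : (k * (l + F b) <= b)%N by move: kb; rewrite mulSn; lia.
have {}IH := IH kb; rewrite mulSn.
apply: (le_trans (probability_misses_split_le sys indep lb kb)).
have P0 A : 0 <= Pr A by exact: fine_probability_ge0.
rewrite exprS -mulrA mulrCA [leRHS]mulrCA ler_wpM2l//.
apply: (@le_trans _ _ (2 * Pr (M b (k * (l + F b))))); last exact: ler_wpM2l.
by rewrite ler_wpM2r//; lra.
Qed.

(* [x ^+ k.+1 <= 4 * (p + r)] with [x] the [k]-th root of [a]. *)
Lemma le_powR_of_root (a c p r : R) (k : nat) : (0 < k)%N ->
  0 <= a -> 0 <= c -> 0 <= p -> 0 <= r ->
  a <= (2 * c) ^+ k -> a * c <= 2 * (p + r) ->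
  a <= 8 * (p `^ (k%:R / k.+1%:R) + r `^ (k%:R / k.+1%:R)).
Proof.
move=> k0 a0 c0 p0 r0 ac ac2.
set s := k%:R / k.+1%:R.
have k0' : 0 < k%:R :> R by rewrite ltr0n.
have s0 : 0 <= s by rewrite divr_ge0.
have s1 : s <= 1 by rewrite ler_pdivrMr ?ltr0n// mul1r ler_nat.
set x := a `^ (k%:R^-1).
have x0 : 0 <= x by exact: powR_ge0.
have xk : x ^+ k = a.
  by rewrite -powR_mulrn// /x -powRrM mulVf ?powRr1// gt_eqF.
have xc : x <= 2 * c.
  have c20 : 0 <= 2 * c by rewrite mulr_ge0.
  by rewrite -(@ler_pXn2r _ k)// ?nnegrE// xk.
(* [x ^+ k.+1 = a * x <= 2 * (a * c) <= 4 * (p + r)], and [p + r] is at most twice the maximum. *)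
have xk1 : x ^+ k.+1 <= 8 * Num.max p r.
  have h1 : p <= Num.max p r by rewrite le_max lexx.
  have h2 : r <= Num.max p r by rewrite le_max lexx orbT.
  rewrite exprSr xk.
  apply: (@le_trans _ _ (a * (2 * c))); first exact: ler_wpM2l.
  rewrite mulrCA; lra.
have m0 : 0 <= Num.max p r by rewrite le_max p0.
have -> : a = (x ^+ k.+1) `^ s.
  rewrite -powR_mulrn// -powRrM /s mulrCA divff ?pnatr_eq0// mulr1.
  by rewrite powR_mulrn.
apply: (@le_trans _ _ ((8 * Num.max p r) `^ s)).
  by apply: ge0_ler_powR; rewrite ?nnegrE ?exprn_ge0// mulr_ge0.
rewrite powRM//; apply: ler_pM; rewrite ?powR_ge0//.
  by apply: ler1_powR => //; rewrite ler1n.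
by case: (leP p r) => _; rewrite ?lerDl ?lerDr powR_ge0.
Qed.

(** With [l] about [b / (2k + 1)], [k] blocks and [k] gaps of length at most [l] fit into [b - l].
    If instead the gap exceeds [l], the gap bound forces [b * mu (B b) <= 1 / 2], so [E b] has
    probability at least [1 / 2] and the claim is trivial. *)
Lemma probability_misses_le_powR (k b : nat) :
  let l := (b %/ (2 * k).+1)%N in
  (0 < k)%N -> (0 < l)%N -> eta b <= 2^-1 ->
  (F b)%:R * Pr (B b) <= q b -> (2 * k).+1%:R * q b <= 2^-1 ->
  Pr (M b (b - l)) <=
    8 * (Pr (E b) `^ (k%:R / k.+1%:R) + q b `^ (k%:R / k.+1%:R)).
Proof.
move=> l k0 l0 etab gapb qb.
have lb : (l * (2 * k).+1 <= b)%N by exact: leq_trunc_div.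
have kl : (2 * k * l <= b - l)%N by rewrite mulnC; lia.
have l_le_b : (l <= b)%N by nia.
have b0 : (0 < b)%N by lia.
have P0 A : 0 <= Pr A by exact: fine_probability_ge0.
have mM i : measurable (M b i) by exact: (measurable_misses sys).
have q0 : 0 <= q b by exact: powR_ge0.
have [Fl|lF] := leqP (F b) l.
  have kbl : (k * (l + F b) <= b - l)%N by nia.
  apply: (@le_powR_of_root _ (Pr (M b l))) => //.
    have lb' : (0 < l <= b)%N by rewrite l0.
    have kb' : (k * (l + F b) <= b)%N by lia.
    apply: le_trans (probability_misses_blocks_le lb' _ kb'); last lra.
    by apply: le_fine_probability => //; exact: sub_misses.
  have nb : (0 < b - l <= b)%N by nia.
  have := probability_misses_split_ge sys indep nb l_le_b.
  (* The length here is [b + F b >= b]. The factor [1 - eta b >= 1 / 2] then gives the 2 in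
     [2 * (p + r)]. *)
  have : Pr (M b (b - l + F b + l)) <= Pr (E b).
    rewrite miss_setE; apply: le_fine_probability => //.
    by apply: sub_misses => //; lia.
  have h : 0 <= Pr (M b (b - l)) * Pr (M b l) by rewrite mulr_ge0.
  nra.
have bF : (b <= (2 * k).+1 * F b)%N.
  have := divn_eq b (2 * k).+1; have := ltn_mod b (2 * k).+1.
  rewrite -/l; nia.
have Eb : 2^-1 <= Pr (E b).
  have := probability_misses_ge sys b b0; rewrite -miss_setE.
  have : b%:R * Pr (B b) <= (2 * k).+1%:R * ((F b)%:R * Pr (B b)).
    by rewrite mulrA ler_wpM2r// -natrM ler_nat.
  have : (2 * k).+1%:R * ((F b)%:R * Pr (B b)) <= (2 * k).+1%:R * q b.
    by rewrite ler_wpM2l.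
  lra.
have Es : Pr (E b) <= Pr (E b) `^ (k%:R / k.+1%:R).
  apply: ger1_powR; last by rewrite ler_pdivrMr ?ltr0n// mul1r ler_nat.
  rewrite fine_probability_le1 ?andbT//; last exact: (measurable_miss_set sys).
  lra.
have h1 := fine_probability_le1 mu (mM (b - l)%N).
have h2 : 0 <= q b `^ (k%:R / k.+1%:R) by exact: powR_ge0.
lra.
Qed.

(* An orbit avoiding [B m] for [m] steps avoids [B b] for [b - b %/ L] steps,
   for each of the at least [m / L] indices [m <= b <= m + m %/ L]. *)
Lemma probability_bigcup_miss_set_le (L m N : nat) : (0 < L)%N -> (0 < m)%N ->
  Pr (\bigcup_(i in [set i | (m <= i < N)%N]) E i) <= (2 * L)%:R *
    \sum_(m <= b < 2 * N) b%:R^-1 * Pr (M b (b - b %/ L)).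
Proof.
move=> L0 m0; set U := \bigcup_(_ in _) _.
have mE := measurable_miss_set sys.
have mU : measurable U by exact: bigcup_measurable.
have L20 : 0 < (2 * L)%:R :> R by rewrite ltr0n muln_gt0.
rewrite -ler_pdivrMl//.
apply: (@le_has_integral _ _ _ mu (fun x => (2 * L)%:R^-1 * \1_U x)
  (fun x => \sum_(m <= b < 2 * N) b%:R^-1 * \1_(M b (b - b %/ L)) x)).
- by apply: has_integralZ; [rewrite invr_ge0 ltW|exact: has_integral_indic].
- apply: has_integral_sum => b; rewrite mem_index_iota => /andP[mb _].
  apply: has_integralZ; first by rewrite invr_ge0.
  by apply/has_integral_indic/(measurable_misses sys); lia.
move=> x; have t0 b : 0 <= b%:R^-1 * \1_(M b (b - b %/ L)) x :> R.
  by rewrite mulr_ge0// invr_ge0.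
have [Ux|nUx] := pselect (U x); last first.
  by rewrite indicE memNset// mulr0 sumr_ge0.
rewrite indicE mem_set// mulr1.
have [i /= /andP[mi iN] Eix] := Ux.
have i0 : (0 < i)%N by lia.
set j := (i + i %/ L).+1.
have iL : (i %/ L <= i)%N by exact: leq_div.
have iN2 : (i <= 2 * N)%N by clear -iN; lia.
have ij : (i <= j)%N by rewrite /j -addnS leq_addr.
have jN2 : (j <= 2 * N)%N.
  by rewrite mul2n -addnn /j -addnS leq_add// ?(leq_ltn_trans iL iN)// ltnW.
rewrite (big_cat_nat mi iN2)/= (big_cat_nat ij jN2)/=.
rewrite addrCA; apply: ler_wpDr; first by rewrite addr_ge0// sumr_ge0.
(* There are [i %/ L + 1 > i / L] indices, each of weight at least [1 / (2 i)], for a total of at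
   least [1 / (2 L)]. *)
apply: (@le_trans _ _ (\sum_(i <= b < j) (2 * i)%:R^-1)).
  rewrite sumr_const_nat -[leRHS]mulr_natr -(ler_pM2l L20) mulfV ?gt_eqF//.
  rewrite mulrCA mulrC ler_pdivlMr ?ltr0n ?muln_gt0//.
  rewrite mul1r -natrM ler_nat.
  have := ltn_ceil i L0; rewrite /j; nia.
apply: ler_sum_nat => b /andP[ib bj].
have b0 : (0 < b)%N by lia.
rewrite indicE mem_set ?mulr1; last first.
  move: Eix; rewrite miss_setE.
  apply: sub_misses; last exact: (target_nested sys i0 ib).
  (* [b <= i + i %/ L <= i + b %/ L], so the first [b - b %/ L] iterates are among the first [i]. *)
  have := leq_div2r L ib; rewrite /j in bj; lia.
rewrite lef_pV2 ?posrE ?ltr0n ?muln_gt0// ler_nat; lia.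
Qed.

Lemma eventually_always_hitting_full (eps : R) : 0 < eps ->
  (\sum_(1 <= n <oo) (mu (E n) `^ (1 - eps) / n%:R%:E) < +oo)%E ->
  mu (eventually_always_hitting T B) = 1%E.
Proof.
move=> eps0 cvE.
have mE := measurable_miss_set sys.
have mH := measurable_eventually_always_hitting sys.
have P0 A : 0 <= Pr A by exact: fine_probability_ge0.
have w0 (n : nat) : 0 <= n%:R^-1 :> R by rewrite invr_ge0.
(* For [s = k / (k + 1)] these conditions say [s >= 1 - eps], which reaches the assumed series, and
   [(1 + delta) s >= 1 + delta / 2], which keeps the logarithmic series convergent. *)
have [k k0 [keps kdelta]] : exists2 k : nat, (0 < k)%N &
    k.+1%:R^-1 <= eps /\ (1 + delta) / k.+1%:R <= delta / 2.
  pose a := Num.max eps^-1 ((1 + delta) / (delta / 2)).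
  have a0 : 0 <= a by rewrite le_max invr_ge0 ltW.
  have := archi_boundP a0; set k := Num.bound a => ak.
  have k0 : (0 < k)%N by rewrite -(ltr0n R); exact: le_lt_trans ak.
  exists k => //.
  have k1 : a < k.+1%:R by apply: lt_le_trans ak _; rewrite ler_nat.
  have k10 : 0 < k.+1%:R :> R by rewrite ltr0n.
  split.
    rewrite -[leRHS]invrK lef_pV2 ?posrE ?invr_gt0//; apply: le_trans (ltW k1).
    by rewrite le_max lexx.
  rewrite ler_pdivrMr// mulrC -ler_pdivrMr ?divr_gt0//.
  by apply: le_trans (ltW k1); rewrite le_max lexx orbT.
pose s : R := k%:R / k.+1%:R.
have sE : s = 1 - k.+1%:R^-1.
  by rewrite /s -[k.+1%:R]natr1; field; rewrite natr1 pnatr_eq0.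
have s0 : 0 < s by rewrite divr_gt0 ?ltr0n.
pose L := (2 * k).+1.
pose u n : R := n%:R^-1 * Pr (E n) `^ (1 - eps).
pose v n : R := n%:R^-1 * ln n%:R `^ (- (1 + delta / 2)).
have u0 n : 0 <= u n by rewrite mulr_ge0 ?powR_ge0.
have v0 n : 0 <= v n by rewrite mulr_ge0 ?powR_ge0.
have : (\sum_(1 <= n <oo) (u n)%:E < +oo)%E.
  apply: le_lt_trans cvE; rewrite le_eqVlt; apply/orP; left; apply/eqP.
  apply: (@congr_lim _ (fun N => \sum_(1 <= n < N) (u n)%:E)%E).
  apply/funext => N; apply: eq_big_nat => n /andP[n0 _].
  rewrite inver pnatr_eq0 -leqn0 leqNgt n0/= /u mulrC EFinM -poweR_EFin.
  by rewrite fine_probabilityK.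
move=> /(nneseries_ltyP _ u0)[K uK].
have tail (e : R) : 0 < e ->
    \forall m \near \oo, forall N, \sum_(m <= n < N) (u n + v n) <= e.
  move=> e0; have e20 : 0 < e / 2 by rewrite divr_gt0.
  have d20 : 0 < delta / 2 by rewrite divr_gt0.
  have hu := sum_tail_le u0 uK e20.
  have hv := sum_tail_le v0 (fun N => sum_inv_ln_powR_le N d20 (ltnSn 2)) e20.
  apply: filterS2 hu hv => m hu hv N.
  by rewrite big_split/= [X in _ <= X]splitr lerD.
have bound : \forall b \near \oo,
    b%:R^-1 * Pr (M b (b - b %/ L)) <= 8 * (u b + v b).
  near=> b.
  (* [ln b >= 1] gives [q b <= 1 / ln b], and [ln b >= 2 L] then gives [L * q b <= 1 / 2]. *)
  have ln1 : 1 <= ln b%:R :> R by near: b; exact: near_ln_ge.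
  have lnL : 2 * L%:R <= ln b%:R :> R by near: b; exact: near_ln_ge.
  have bL : (L <= b)%N by near: b; exact: nbhs_infty_ge.
  have ln0 : 0 < ln b%:R :> R by lra.
  rewrite -mulrDr mulrCA ler_wpM2l//.
  have qb : L%:R * q b <= 2^-1.
    apply: (@le_trans _ _ (L%:R * (ln b%:R)^-1)).
      rewrite ler_wpM2l// -(powR_inv1 (ltW ln0)); apply: ler_powR => //.
      by rewrite lerN2 lerDl ltW.
    by rewrite ler_pdivrMr//; lra.
  have etab : eta b <= 2^-1.
    by near: b; apply: (near_eta_le eta_cvg0).
  have gapb : (F b)%:R * Pr (B b) <= q b by near: b; exact: gap.
  have l0 : (0 < b %/ L)%N by rewrite divn_gt0.
  apply: (le_trans (probability_misses_le_powR k0 l0 etab gapb qb)).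
  rewrite -/s ler_pM2l//; apply: lerD.
    have [->|Eb0] := eqVneq (Pr (E b)) 0.
      by rewrite powR0 ?powR_ge0// gt_eqF.
    apply: ger_powR; last by rewrite sE lerD2l lerN2.
    by rewrite lt_def Eb0 P0 fine_probability_le1.
  rewrite -powRrM; apply: ler_powR => //; rewrite sE.
  move: kdelta; set t := k.+1%:R^-1 => kdelta.
  rewrite mulNr lerN2 mulrBr mulr1 -addrA lerD2l lerBrDr.
  by rewrite [leRHS]splitr lerD2l.
have small (e : R) : 0 < e -> (mu (~` eventually_always_hitting T B) <= e%:E)%E.
  move=> e0.
  (* This absorbs the factor [2 L] of the union estimate and the 8 of [bound]. *)
  pose e' := e / ((2 * L)%:R * 8).
  have L20 : 0 < (2 * L)%:R * 8 :> R by rewrite mulr_gt0// ltr0n muln_gt0.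
  have e'0 : 0 < e' by rewrite divr_gt0.
  have [m1 _ h1] := tail _ e'0; have [m2 _ h2] := bound.
  pose m := maxn 1 (maxn m1 m2).
  (* The bound on these finite unions is uniform in [N], so it passes to the full union by
     continuity from below. *)
  pose U N := \bigcup_(i in [set i | (m <= i < N)%N]) E i.
  have mU N : measurable (U N) by exact: bigcup_measurable.
  have UP N : (mu (U N) <= e%:E)%E.
    rewrite -(fine_probabilityK mu (mU N)) lee_fin.
    apply: (le_trans (@probability_bigcup_miss_set_le L m N _ _)) => //.
      lia.
    apply: (@le_trans _ _ ((2 * L)%:R * (8 * e'))); last first.
      by rewrite /e' mulrA mulrC divfK// gt_eqF.
    rewrite ler_wpM2l//.
    apply: (@le_trans _ _ (8 * \sum_(m <= b < 2 * N) (u b + v b))).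
      rewrite mulr_sumr; apply: ler_sum_nat => b /andP[mb _].
      by apply: h2 => /=; lia.
    by rewrite ler_pM2l//; apply: h1 => /=; lia.
  have mUU : measurable (\bigcup_N U N) by exact: bigcupT_measurable.
  apply: (@le_trans _ _ (mu (\bigcup_N U N))).
    apply: le_measure; rewrite ?inE//; first exact: measurableC.
    rewrite eventually_always_hittingE => x /= nx.
    apply: contrapT => nU; apply: nx; exists m => // n /= mn En.
    by apply: nU; exists n.+1 => //; exists n => //=; rewrite mn /=.
  apply: (@cvge_le _ \oo _ _ (mu \o U)); first by apply: nearW => N; exact: UP.
  apply: nondecreasing_cvg_mu => // i j ij; apply/subsetPset => x.
  move=> [n /= /andP[mn ni] En]; exists n => //=; rewrite mn/=.
  exact: leq_trans ij.
have : mu (~` eventually_always_hitting T B) = 0%E.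
  apply/eqP; rewrite eq_le measure_ge0 andbT.
  by apply/lee_addgt0Pr => e e0; rewrite add0e; exact: small.
rewrite probability_setC// -(fine_probabilityK mu mH) -EFinB.
move=> /(congr1 fine)/= h.
by congr EFin; lra.
Unshelve. all: by end_near.
Qed.

End Convergence.

(** * The gap condition in real form, and the two cases combined *)

Lemma gap_bound (R : realFieldType) (f l beta : R) : 0 < l -> 0 <= beta ->
  (f%:E <= (l%:E * beta%:E)^-1)%E -> f * beta <= l^-1.
Proof.
move=> l0; rewrite le_eqVlt => /orP[/eqP <- _|b0].
  (* At [beta = 0] the inverse in [\bar R] is [+oo] and bounds nothing, but the conclusion reads
     [0 <= l^-1]. *)
  by rewrite mulr0 invr_ge0 ltW.
rewrite -EFinM inver mulf_eq0 !gt_eqF//= lee_fin => h.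
by rewrite -ler_pdivlMr// -invfM.
Qed.

Theorem theorem1p1 (R : realType) (d : measure_display)
    (X : measurableType d) (mu : probability X R) (T : X -> X)
    (B : nat -> set X)
    (hsys : shrinking_target_system mu T B)
    (hlti : long_term_independence mu T B) :
  ((exists2 eps : R, 0 < eps &
      (\sum_(1 <= n <oo) (mu (miss_set T B n) `^ (1 - eps) / n%:R%:E) < +oo)%E)
    -> mu (eventually_always_hitting T B) = 1%E) /\
  ((\sum_(1 <= n <oo) (mu (miss_set T B n) / n%:R%:E) = +oo)%E
    -> mu (eventually_always_hitting T B) = 0%E).
Proof.
have [eta [F [eta01 eta0 [delta delta0 gap] indep]]] := hlti.
have gapR : \forall n \near \oo,
    (F n)%:R * fine (mu (B n)) <= ln n%:R `^ (- (1 + delta)).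
  near=> n.
  have n0 : (0 < n)%N by near: n; exact: nbhs_infty_ge.
  have ln1 : 1 <= ln n%:R :> R by near: n; exact: near_ln_ge.
  rewrite powRN; apply: gap_bound.
  - by rewrite powR_gt0//; lra.
  - exact: fine_probability_ge0.
  - rewrite fine_probabilityK; first by near: n.
    exact: (sts_measurable_target hsys).
split=> [[eps eps0 cvE]|divE].
  exact: (eventually_always_hitting_full hsys indep eta0 delta0 gapR eps0 cvE).
apply: (eventually_always_hitting_null hsys indep _ eta0 delta0 gapR divE).
by move=> m /eta01/andP[].
Unshelve. all: by end_near.
Qed.
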